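(* For every integer $n\ge 1$ and every fair division instance $(N,M,(v_i)_{i\in N})$ with $|N|=n$ agents, a finite set $M$ of indivisible goods and additive valuations, there exists a $1$-out-of-$4\lceil n/3\rceil$ MMS allocation; that is, setting $d=4\lceil n/3\rceil$, there is a partition $X=(X_i)_{i\in N}$ of $M$ (parts may be empty) such that $v_i(X_i)\ge \mathrm{MMS}_i^{d}(M)$ for every agent $i\in N$.
   Context: A fair division instance $(N,M,(v_i)_{i\in N})$ consists of a finite set $N$ of agents, a finite set $M$ of indivisible goods, and for each agent $i$ a valuation $v_i:2^M\to\mathbb{R}_{\ge 0}$ that is additive: $v_i(S)=\sum_{g\in S}v_i(\{g\})$. For a positive integer $d$, let $\Pi_d(M)$ be the set of all partitions of $M$ into $d$ (possibly empty) bundles, and define $\mathrm{MMS}_i^d(M)=\max_{(P_1,\dots,P_d)\in\Pi_d(M)}\min_{1\le j\le d}v_i(P_j)$. *)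

(* Defs.v *)
From mathcomp Require Import all_boot all_order all_algebra reals.

Set Implicit Arguments.
Unset Strict Implicit.
Unset Printing Implicit Defensive.

Import Order.TTheory GRing.Theory Num.Theory.
Local Open Scope ring_scope.

Definition ceil_div (m k : nat) : nat := ((m + k.-1) %/ k)%N.

Lemma ceil_divE (m k : nat) : (0 < k)%N ->
  (ceil_div m k)%:Z = Num.ceil (m%:R / k%:R : rat).
Proof.
move=> k0; apply/esym/ceil_def; rewrite /ceil_div.
set c := ((m + k.-1) %/ k)%N.
have kq : (0 : rat) < k%:R by rewrite ltr0n.
have E := divn_eq (m + k.-1) k; rewrite -/c in E.
have L := ltn_pmod (m + k.-1) k0.
rewrite ltr_pdivlMr // ler_pdivrMr // intrD mulrDl mulN1r ltrBlDr.
rewrite -!pmulrn -!natrM -natrD ltr_nat ler_nat.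
case: k k0 {kq} @c E L => // k _ c E L; rewrite /= in E L *.
apply/andP; split.
  by rewrite addnS ltnS E leq_addr.
by rewrite -(leq_add2r k) E leq_add2l.
Qed.

(* Parts may be empty, unlike in [finset.partition]; taking I := 'I_d gives the
   partitions (P_1, ..., P_d) of M into d bundles, and taking I to be the set of
   agents gives the allocations of M. *)
Definition bundle_partition (I M : finType) (P : {ffun I -> {set M}}) : bool :=
  [forall i, forall j, (i != j) ==> [disjoint P i & P j]]
  && (\bigcup_i P i == [set: M]).

Definition additive_valuation (R : realType) (M : finType)
    (v : {set M} -> R) : Prop :=
  (forall S, 0 <= v S) /\ (forall S, v S = \sum_(g in S) v [set g]).

(* The defaults of the two big operators are neutral: every bundle has value at
   most v M and every partition has nonnegative least value (see [MMS_max]).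
   Only d > 0 is meaningful. *)
Definition min_value (R : realType) (M : finType) (v : {set M} -> R) (d : nat)
    (P : {ffun 'I_d -> {set M}}) : R :=
  \big[Num.min/v [set: M]]_(j < d) v (P j).

Definition MMS (R : realType) (M : finType) (v : {set M} -> R) (d : nat) : R :=
  \big[Num.max/0]_(P : {ffun 'I_d -> {set M}} | bundle_partition P)
    min_value v P.

Lemma additive_le_setT (R : realType) (M : finType) (v : {set M} -> R) S :
  additive_valuation v -> v S <= v [set: M].
Proof.
case=> v0 vD; rewrite (vD S) (vD setT) [leRHS](big_setID S) /= setTI.
by rewrite lerDl; apply: sumr_ge0 => g _.
Qed.

Lemma min_value_min (R : realType) (M : finType) (v : {set M} -> R) (d : nat)
    (P : {ffun 'I_d -> {set M}}) : (0 < d)%N -> additive_valuation v ->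
  (exists j, min_value v P = v (P j)) /\ (forall j, min_value v P <= v (P j)).
Proof.
move=> d0 va; split; last by move=> j; apply: bigmin_le_cond.
rewrite /min_value.
have [j _ ->] := @eq_bigmin _ _ _ (v setT) (Ordinal d0) predT
  (fun j => v (P j)) isT (fun j _ => additive_le_setT (P j) va).
by exists j.
Qed.

Lemma bundle_partition_exists (M : finType) (d : nat) : (0 < d)%N ->
  exists P : {ffun 'I_d -> {set M}}, bundle_partition P.
Proof.
case: d => // d _; exists [ffun j => if j == ord0 then setT else set0].
apply/andP; split.
  apply/forallP=> i; apply/forallP=> j; apply/implyP; rewrite !ffunE.
  case: (altP (i =P ord0)) => [->|_ _]; last by rewrite -setI_eq0 set0I.
  by rewrite eq_sym => /negPf ->; rewrite -setI_eq0 setI0.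
apply/eqP/setP=> g; rewrite inE; apply/bigcupP; exists ord0 => //.
by rewrite ffunE eqxx inE.
Qed.

Lemma MMS_max (R : realType) (M : finType) (v : {set M} -> R) (d : nat) :
  (0 < d)%N -> additive_valuation v ->
  (exists2 P : {ffun 'I_d -> {set M}},
     bundle_partition P & MMS v d = min_value v P) /\
  (forall P : {ffun 'I_d -> {set M}},
     bundle_partition P -> min_value v P <= MMS v d).
Proof.
move=> d0 va; split; last by move=> P hP; apply: le_bigmax_cond.
have [P0 hP0] := bundle_partition_exists M d0.
rewrite /MMS.
have [|P hP ->] := @eq_bigmax _ _ _ 0 P0
  (@bundle_partition _ _) (fun P => min_value v P) hP0.
  by move=> P _; have [[j ->] _] := min_value_min P d0 va; exact: va.1.
by exists P.
Qed.

(* Main.v *)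
(** Normalise every agent so that her 4k bundles (k = ceil(n/3)) are worth exactly 1,
and let all agents rank the goods identically as g_0, g_1, ...: an allocation of such an
ordered instance is turned into one of the original instance by letting the owner of
g_0, g_1, ... pick in turn.  Start from the 3k bags {g_j, g_{6k-1-j}}; process the bags
one by one, filling the current one with goods g_t, t >= 6k, until an unserved agent
values it at 1 or more.  If this gets stuck, some agent values a bag below 1 although all
goods are in bags, every bag being either a bare pair or worth less than 1 to her without
one of its fillers.  This contradicts the total value 4k.  Let p be the largest pair value and
w the value of g_{6k-1}.
- If p - 1 <= max(1/3, w), or if the smaller good of the best pair is below 1/2, put
  beta = max(1/3, w, p - 1) < 1/2 and apply the subadditive [staircase] function with
  step beta: every bundle gets at least 3(1 - 2 beta), every bag at most 4(1 - 2 beta),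
  and one bag strictly less.
- Otherwise the values of the bags are bounded directly: see [stuck_light] when some
  pair {g_j, g_{6k-1-j}} with j >= 2k is worth less than 1, and [stuck_heavy] when none
  is. *)
Require Import Defs.
From mathcomp Require Import all_boot all_order all_algebra reals ring lra zify.

Set Implicit Arguments.
Unset Strict Implicit.
Unset Printing Implicit Defensive.

Import Order.TTheory GRing.Theory Num.Theory.
Local Open Scope ring_scope.

(** * The staircase function *)

Section Staircase.
Context {R : realFieldType}.
Implicit Types (b x y : R).

(* With l = 1 - 2 b: slope 1 on [0, l], constant on [l, b], and then
   staircase b (x + b) = staircase b x + l; as 2 b + l = 1, its value at 1 is 3 l. *)
Definition staircase b x : R :=
  if x <= 1 - 2 * b then x else if x <= b then 1 - 2 * b
  else if x <= 1 - b then x + (1 - 3 * b) else if x <= 2 * b then 2 * (1 - 2 * b)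
  else x + 2 * (1 - 3 * b).

Ltac staircase_cases b x :=
  case: (lerP x (1 - 2 * b)) => ?; last case: (lerP x b) => ?;
  last case: (lerP x (1 - b)) => ?; last case: (lerP x (2 * b)) => ?; try lra.

Lemma staircase_subadd b x y : 1/3 <= b -> b < 1/2 -> 0 <= x -> 0 <= y ->
  x + y <= 1 -> staircase b (x + y) <= staircase b x + staircase b y.
Proof.
move=> b1 b2 x0 y0 xy.
wlog lexy : x y x0 y0 xy / x <= y.
  case: (lerP x y) => [h|/ltW h] H; [|rewrite (addrC x) [leRHS]addrC]; apply: H; lra.
rewrite /staircase.
by staircase_cases b x; staircase_cases b y; staircase_cases b (x + y).
Qed.

Lemma staircase_le b x : b < 1/2 -> 1/3 <= b -> 0 <= x -> staircase b x <= x.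
Proof. by move=> b2 b1 x0; rewrite /staircase; do ! case: ifP; lra. Qed.

Lemma staircase_sum (I : finType) (Q : pred I) (x : I -> R) b :
  1/3 <= b -> b < 1/2 -> (forall i, 0 <= x i) -> \sum_(i | Q i) x i <= 1 ->
  staircase b (\sum_(i | Q i) x i) <= \sum_(i | Q i) staircase b (x i).
Proof.
move=> b1 b2 x0.
(* Subadditivity is available only up to 1, so the induction carries the inequality conditionally on
   the partial sum. *)
pose K y z := 0 <= y /\ (y <= 1 -> staircase b y <= z).
suff [_] : K (\sum_(i | Q i) x i) (\sum_(i | Q i) staircase b (x i)) by [].
apply: (big_ind2 K) => [|y1 z1 y2 z2 [p1 h1] [p2 h2]|i _]; split=> //.
- by rewrite /staircase ifT //; lra.
- exact: addr_ge0.
- move=> le1; apply: le_trans (staircase_subadd b1 b2 p1 p2 le1) _.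
  by apply: lerD; [apply: h1|apply: h2]; lra.
Qed.

Lemma staircase_le_step b x : 1/3 <= b -> 0 <= x -> x <= b -> staircase b x <= 1 - 2 * b.
Proof. by move=> b1 x0 xb; rewrite /staircase xb; case: ifP; lra. Qed.

(** The flat stretches [1 - 2b, b] and [1 - b, 2b] both have length [3 * b - 1]; crossing one loses
    exactly that much against the identity. *)
Lemma staircase_le_mid b x : 1/3 <= b -> b <= x -> x <= 1 ->
  staircase b x <= x - (3 * b - 1).
Proof. by move=> b1 bx x1; rewrite /staircase; do ! case: ifP; lra. Qed.

Lemma staircase_top b x : 1/3 <= b -> b < 1/2 -> 2 * b <= x ->
  staircase b x = x - 2 * (3 * b - 1).
Proof. by move=> b1 b2 bx; rewrite /staircase; do ! case: ifP; lra. Qed.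

Lemma staircase1 b : 1/3 <= b -> b < 1/2 -> staircase b 1 = 3 * (1 - 2 * b).
Proof. by move=> b1 b2; rewrite staircase_top //; lra. Qed.

(** If [x <= 2 * b], both terms are at most 2(1 - 2b). If x = 2b + z with z >= 0, the first is 2(1 -
    2b) + z, but y <= 1 - b - z keeps the second at most 2(1 - 2b) - z. *)
Lemma staircase_pair b x y : 1/3 <= b -> b < 1/2 -> 0 <= y -> y <= x -> x <= 1 ->
  x + y <= 1 + b -> staircase b x + staircase b y <= 4 * (1 - 2 * b).
Proof.
by move=> b1 b2 y0 yx x1 xy; rewrite /staircase; staircase_cases b x; staircase_cases b y.
Qed.

Lemma staircase_pair_lt b x y : 1/3 <= b -> b < 1/2 -> 0 <= y -> y <= x -> x <= 1 ->
  x + y < 1 -> staircase b x + staircase b y < 4 * (1 - 2 * b).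
Proof.
by move=> b1 b2 y0 yx x1 xy; rewrite /staircase; staircase_cases b x; staircase_cases b y.
Qed.
End Staircase.

(** * Bag filling *)

Definition bag {G J : finType} (base : J -> {set G}) (P : {set G}) (f : G -> J) (j : J)
    : {set G} :=
  base j :|: [set g in P | f g == j].

Lemma ler_sum_subset (R : realFieldType) (G : finType) (w : G -> R) (A B : {set G}) :
  (forall g, 0 <= w g) -> A \subset B -> \sum_(g in A) w g <= \sum_(g in B) w g.
Proof.
move=> w0 sAB; rewrite [leRHS](big_setID A) /= (setIidPr sAB) lerDl.
exact: sumr_ge0.
Qed.

(** Induction on the size of [A]. If no agent of [A] accepts the current bag even with all of [P],
    putting [P] there gives the second alternative. Otherwise one agent leaves with a minimal
    filling; minimality with respect to all of [A] bounds this bag for an agent who gets stuck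
    later. *)
Lemma bag_filling (R : realFieldType) (N G J : finType) (u : N -> G -> R)
    (base : J -> {set G}) (j0 : J) (A : {set N}) (B : {set J}) (P : {set G}) :
  (forall i g, 0 <= u i g) -> (#|A| <= #|B|)%N ->
  (exists (h : N -> J) (f : G -> J),
     [/\ {in A &, injective h}, {in A, forall i, h i \in B} &
         {in A, forall i, 1 <= \sum_(g in bag base P f (h i)) u i g}]) \/
  (exists i (f : G -> J),
     [/\ i \in A, {in P, forall g, f g \in B},
         {in B, forall j, (forall g, g \in P -> f g != j) \/
            exists e, [/\ e \in P, f e = j &
              \sum_(g in bag base P f j :\ e) u i g < 1]} &
         exists2 j, j \in B & \sum_(g in bag base P f j) u i g < 1]).
Proof.
move=> u0; have [n] := ubnP #|A|; elim: n => // n IH in A B P *; rewrite ltnS => An.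
have [-> _|[i1 i1A] AB] := set_0Vmem A.
  by left; exists (fun=> j0), (fun=> j0); split=> [i1 i2|i|i]; rewrite inE.
have [j jB] : exists j, j \in B.
  by apply/card_gt0P; apply: leq_trans AB; apply/card_gt0P; exists i1.
pose good (F : {set G}) :=
  (F \subset P) && [exists i in A, 1 <= \sum_(g in base j :|: F) u i g].
(* An inclusion-minimal good filling is worth less than 1 to every agent
   once any of its elements is removed. *)
have [gP|ngP] := boolP (good P); last first.
  have lt1 (S : {set G}) : S \subset base j :|: P -> \sum_(g in S) u i1 g < 1.
    move=> sS; rewrite (le_lt_trans (ler_sum_subset (u0 i1) sS)) // ltNge.
    apply: contra ngP => h; rewrite /good subxx; apply/existsP; exists i1.
    by rewrite i1A.
  right; exists i1, (fun=> j); split=> // [j' j'B|].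
    have [->|nj] := eqVneq j' j; last by left.
    have [->|[e eP]] := set_0Vmem P; first by left=> g; rewrite inE.
    right; exists e; split=> //; apply: lt1; apply/subsetP => g.
    by rewrite !inE; case: (g \in base j); case: (g \in P); rewrite ?andbF.
  exists j => //; apply: lt1; apply/subsetP => g.
  by rewrite !inE; case: (g \in base j); case: (g \in P).
have [F /minsetP[/andP[sFP /existsP[i /andP[iA i1F]]] minF] _] := minset_exists gP.
have Fe i' e : i' \in A -> e \in F -> \sum_(g in (base j :|: F) :\ e) u i' g < 1.
  move=> i'A eF; rewrite ltNge; apply/negP => h.
  have : F :\ e = F.
    apply: minF; last exact: subsetDl.
    rewrite /good (subset_trans (subsetDl _ _) sFP); apply/existsP; exists i'.
    rewrite i'A; apply: le_trans h (ler_sum_subset (u0 i') _).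
    by apply/subsetP => g; rewrite !inE; case: (g == e); case: (g \in base j).
  by move/setP/(_ e); rewrite !inE eqxx eF.
have cA : (#|A :\ i| < n)%N by apply: leq_trans An; rewrite [ltnRHS](cardsD1 i) iA.
have cB : (#|A :\ i| <= #|B :\ j|)%N.
  by move: AB; rewrite (cardsD1 i A) iA (cardsD1 j B) jB.
pose ext (f : G -> J) g := if g \in F then j else f g.
have bagE f j' : j' != j -> bag base P (ext f) j' = bag base (P :\: F) f j'.
  move=> nj; apply/setP => g; rewrite !inE /ext; case: (g \in F) => //=.
  by rewrite eq_sym (negPf nj) andbF.
have subF f : base j :|: F \subset bag base P (ext f) j.
  apply/setUS/subsetP => g gF; rewrite inE (subsetP sFP) //= /ext gF; exact: eqxx.
case: (IH (A :\ i) (B :\ j) (P :\: F) cA cB) => [[h [f [hI hB h1]]]|[i' [f [i'A fB fF fS]]]].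
- left; exists (fun i' => if i' == i then j else h i'), (ext f); split.
  + have hj x : x \in A -> x != i -> h x != j.
      by move=> xA xi; have := hB x; rewrite !inE xi xA => /(_ isT) /andP[].
    move=> x y xA yA; have [->|xi] := eqVneq x i; have [->|yi] := eqVneq y i => //.
    * by move=> e; move: (hj y yA yi); rewrite -e eqxx.
    * by move=> e; move: (hj x xA xi); rewrite e eqxx.
    * by apply: hI; rewrite !inE ?xi ?yi.
  + move=> x xA; have [//|xi] := eqVneq x i.
    by have := hB x; rewrite !inE xi xA => /(_ isT) /andP[].
  + move=> x xA; have [->|xi] := eqVneq x i.
      exact: le_trans i1F (ler_sum_subset (u0 i) (subF f)).
    have xA' : x \in A :\ i by rewrite !inE xi.
    have := hB x xA'; rewrite !inE => /andP[nj _].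
    by rewrite bagE // h1.
- have bagj : bag base P (ext f) j = base j :|: F.
    apply/eqP; rewrite eqEsubset subF andbT; apply/setUS/subsetP => g.
    rewrite inE /ext => /andP[gP']; case: ifPn => // gF /eqP fj.
    by have := fB g; rewrite !inE gF gP' fj eqxx => /(_ isT).
  move: i'A; rewrite !inE => /andP[ni i'A].
  right; exists i', (ext f); split=> //.
  + move=> g gP'; rewrite /ext; case: ifPn => // gF.
    by have := fB g; rewrite !inE gF gP' => /(_ isT) /andP[].
  + move=> j' j'B; have [->|nj] := eqVneq j' j.
      have [F0|[e eF]] := set_0Vmem F.
        left=> g gP'; rewrite /ext F0 inE.
        by have := fB g; rewrite F0 !inE gP' => /(_ isT) /andP[].
      right; exists e; split; first exact: (subsetP sFP).
        by rewrite /ext eF.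
      by rewrite bagj; apply: Fe.
    have [|fF'|[e [eP fe e1]]] := fF j'; first by rewrite !inE nj.
      left=> g gP'; rewrite /ext; case: ifPn => [_|gF]; first by rewrite eq_sym.
      by apply: fF'; rewrite !inE gF.
    move: eP; rewrite !inE => /andP[eF eP].
    right; exists e; split=> //; first by rewrite /ext (negPf eF).
    by rewrite bagE.
  + case: fS => j'; rewrite !inE => /andP[nj j'B] lt1.
    by exists j' => //; rewrite bagE.
Qed.

(** * Contradiction for an agent left without a bag *)

Lemma ltr_sum_le (R : realFieldType) (J : finType) (F G : J -> R) (j : J) :
  (forall i, F i <= G i) -> F j < G j -> \sum_i F i < \sum_i G i.
Proof.
move=> leFG lt; rewrite (bigD1 j) //= [ltRHS](bigD1 j) //=.
by apply: ltr_leD => //; apply: ler_sum.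
Qed.

Lemma sumr_const_natl (R : pzRingType) (m n : nat) (x : R) :
  \sum_(m <= i < n) x = (n - m)%:R * x.
Proof. by rewrite sumr_const_nat mulr_natl. Qed.

(* The view of an agent left without a bag: [s t] is the value of the t-th good, [c] gives
   her bundles and [f] the bag of each good. *)
Section Stuck.
Context {R : realFieldType} {k L : nat} (s : nat -> R).
Context (c : 'I_L -> 'I_(4 * k)) (f : 'I_L -> 'I_(3 * k)).
Context (s_ge0 : forall t, 0 <= s t).
Context (s_noninc : forall t u, (t <= u)%N -> s u <= s t).
Context (leL : (6 * k <= L)%N).
Context (bundle1 : forall q, \sum_(t < L | c t == q) s t = 1).
Context (f_base : forall (t : 'I_L) (j : 'I_(3 * k)), (t < 6 * k)%N ->
  (f t == j) = (t == j :> nat) || (t == (6 * k - j.+1)%N :> nat)).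
Context (f_fill : forall j, (forall t : 'I_L, f t = j -> (t < 6 * k)%N) \/
  exists e : 'I_L, [/\ (6 * k <= e)%N, f e = j & \sum_(t < L | (f t == j) && (t != e)) s t < 1]).

Let b (j : nat) := s (6 * k - j.+1)%N.

(** A bag with fillers is split around one whose removal brings it below 1. [F] is arbitrary because
    the split serves both [s] and its staircase. *)
Lemma bag_split (j : 'I_(3 * k)) :
  (forall F : nat -> R, \sum_(t < L | f t == j) F t = F j + F (6 * k - j.+1)%N) \/
  exists (e : nat) (rest : pred 'I_L), [/\ (6 * k <= e)%N,
    forall F : nat -> R, \sum_(t < L | f t == j) F t =
      F j + F (6 * k - j.+1)%N + F e + \sum_(t < L | rest t) F t &
    s j + b j + \sum_(t < L | rest t) s t < 1].
Proof.
have jk := ltn_ord j.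
have jL : (j < L)%N by lia.
have jL' : (6 * k - j.+1 < L)%N by lia.
pose ta := Ordinal jL; pose tb := Ordinal jL'.
have fa : f ta == j by rewrite f_base /= ?eqxx //; lia.
have fb : f tb == j by rewrite f_base /= ?eqxx ?orbT //; lia.
have ab : tb != ta by rewrite -val_eqE /=; lia.
have [fj|[e [ek fe lt1]]] := f_fill j.
  left=> F; rewrite (bigD1 ta) // (bigD1 tb) /=; last by rewrite fb.
  rewrite big1 ?addr0 // => t /andP[/andP[ft nta] ntb].
  have := f_base j (fj _ (eqP ft)); rewrite ft => /esym/orP[] /eqP e.
    by move: nta; rewrite -val_eqE /= e eqxx.
  by move: ntb; rewrite -val_eqE /= e eqxx.
right; exists e, (fun t => [&& f t == j, t != e, t != ta & t != tb]).
have ea : ta != e by rewrite -val_eqE /=; lia.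
have eb : tb != e by rewrite -val_eqE /=; lia.
have E (F : nat -> R) : \sum_(t < L | (f t == j) && (t != e)) F t =
   F j + F (6 * k - j.+1)%N + \sum_(t < L | [&& f t == j, t != e, t != ta & t != tb]) F t.
  rewrite (bigD1 ta) ?fa // (bigD1 tb) /= ?fb ?eb // addrA; congr (_ + _).
  by apply: eq_bigl => t; rewrite -!andbA.
split=> //; last by rewrite -E.
by move=> F; rewrite (bigD1 e) /= ?fe // E; ring.
Qed.

Lemma sum_bags (F : nat -> R) :
  \sum_(j < 3 * k) \sum_(t < L | f t == j) F t =
  \sum_(q < 4 * k) \sum_(t < L | c t == q) F t.
Proof.
transitivity (\sum_(t < L) F t); last exact: partition_big.
by apply/esym; apply: partition_big.
Qed.

Lemma sum_bags_value : \sum_(j < 3 * k) \sum_(t < L | f t == j) s t = 4 * k%:R.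
Proof.
rewrite sum_bags (eq_bigr (fun=> 1)); last by move=> q _; apply: bundle1.
by rewrite sumr_const card_ord natrM.
Qed.

Lemma s_le1 t : (t < L)%N -> s t <= 1.
Proof.
move=> tL; rewrite -(bundle1 (c (Ordinal tL))) (bigD1 (Ordinal tL)) //= lerDl.
exact: sumr_ge0.
Qed.

Lemma b_le j : (j < 3 * k)%N -> b j <= s j.
Proof. by move=> jk; apply: s_noninc; lia. Qed.

Lemma b_nondec i j : (i <= j)%N -> b i <= b j.
Proof. by move=> ij; apply: s_noninc; lia. Qed.

Lemma filler_le e j : (6 * k <= e)%N -> s e <= b j.
Proof. by move=> ek; apply: s_noninc; lia. Qed.

Lemma staircase_bags (x : R) (j0 : 'I_(3 * k)) : 1/3 <= x -> x < 1/2 ->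
  \sum_(t < L | f t == j0) s t < 1 ->
  (forall j : 'I_(3 * k), s j + b j <= 1 + x) -> b 0 <= x ->
  (forall j : 'I_(3 * k), s j + b j < 1 -> staircase x (s j) + staircase x (b j) <=
     s j + b j - 2 * (3 * x - 1)) -> False.
Proof.
move=> x1 x2 lt1 pmax b0 pair.
have W_le (j : 'I_(3 * k)) : \sum_(t < L | f t == j) staircase x (s t) <= 4 * (1 - 2 * x) /\
   (\sum_(t < L | f t == j) s t < 1 ->
    \sum_(t < L | f t == j) staircase x (s t) < 4 * (1 - 2 * x)).
  have jk := ltn_ord j.
  have aj1 : s j <= 1 by apply: s_le1; lia.
  have [E|[e [rest [ek E lt]]]] := bag_split j.
    rewrite (E (fun t => staircase x (s t))) (E s); split.
      by apply: staircase_pair => //; rewrite ?b_le ?s_ge0.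
    by move=> h; apply: staircase_pair_lt => //; rewrite ?b_le ?s_ge0.
  rewrite (E (fun t => staircase x (s t))).
  have rest0 : 0 <= \sum_(t < L | rest t) s t by apply: sumr_ge0.
  have le_rest : \sum_(t < L | rest t) staircase x (s t) <= \sum_(t < L | rest t) s t.
    by apply: ler_sum => t _; apply: staircase_le.
  have le_e : staircase x (s e) <= 1 - 2 * x.
    by apply: staircase_le_step => //; apply: le_trans (filler_le 0 ek) b0.
  (* The pair and [rest], together below 1, lose 2(3x - 1), and [e] adds at most 1 - 2x: 1 - 2(3x -
     1) + (1 - 2x) = 4(1 - 2x). *)
  have := pair j; rewrite -/(b j); split; lra.
have : \sum_(j < 3 * k) \sum_(t < L | f t == j) staircase x (s t) <
       \sum_(j < 3 * k) 4 * (1 - 2 * x).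
  by apply: (@ltr_sum_le _ _ _ _ j0) => [j|]; [case: (W_le j)|apply: (W_le j0).2].
apply/negP; rewrite -leNgt (sum_bags (fun t => staircase x (s t))).
(* The bounds on bags and on bundles have the same total, 12k(1 - 2x). *)
apply: le_trans (_ : \sum_(q < 4 * k) 3 * (1 - 2 * x) <= _).
  rewrite !sumr_const !card_ord -[leLHS]mulr_natr -[leRHS]mulr_natr !(natrM _ _ k).
  by rewrite le_eqVlt; apply/orP; left; apply/eqP; ring.
apply: ler_sum => q _; rewrite -(staircase1 x1 x2) -(bundle1 q).
by apply: staircase_sum => //; rewrite ?bundle1.
Qed.

(* With x = s (2 k) >= 1/2, a bundle holding h of the first 6k goods satisfies
   sum min(s t, x) <= (2 x - 1) + h (1 - x); these bounds add up to 2 k + 2 k x. *)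
Lemma sum_pairs_le : \sum_(2 * k <= t < 6 * k) s t <= 2 * k%:R.
Proof.
have [x2|x2] := ltrP (s (2 * k)%N) (1/2).
  apply: le_trans (_ : \sum_(2 * k <= t < 6 * k) 1/2 <= _).
    apply: ler_sum_nat => t /andP[t2 _]; apply: le_trans (s_noninc t2) (ltW x2).
  rewrite sumr_const_natl.
  have -> : (6 * k - 2 * k)%N = (4 * k)%N by lia.
  by rewrite (natrM _ _ k); lra.
set x := s (2 * k)%N in x2 *.
have [/eqP k0|k_gt0] := posnP k; first by rewrite (eqP k0) !muln0 big_geq //; lra.
have x1 : x <= 1 by apply: s_le1; lia.
pose m t := Num.min (s t) x.
have m_le t : m t <= x by rewrite ge_min lexx orbT.
have m_s t : m t <= s t by rewrite ge_min lexx.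
(* With no such good, 2x - 1 >= 0; with one, use [m t <= x]; with two or more, at least 2(1 - x) is
   subtracted from a value of at most 1. *)
have q_le (q : 'I_(4 * k)) :
    \sum_(t < L | (t < 6 * k)%N && (c t == q)) (m t - (1 - x)) <= 2 * x - 1.
  have [t tq|none] := pickP (fun t : 'I_L => (t < 6 * k)%N && (c t == q)); last first.
    by rewrite big_pred0 //; lra.
  have [u /andP[uq ut]|none] :=
    pickP (fun u : 'I_L => ((u < 6 * k)%N && (c u == q)) && (u != t)); last first.
    by rewrite (bigD1 t) // big_pred0 //=; have := m_le t; lra.
  have S1 : s t + (s u +
      \sum_(v < L | ((v < 6 * k)%N && (c v == q)) && (v != t) && (v != u)) s v) <= 1.
    case/andP: (tq) => _ ctq; case/andP: (uq) => _ cuq.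
    rewrite -(bundle1 q) [leRHS](bigD1 t) //= [X in _ <= _ + X](bigD1 u) ?cuq //=.
    rewrite !lerD2l [leRHS](bigID (fun v : 'I_L => (v < 6 * k)%N)) /=.
    rewrite (eq_bigl (fun v : 'I_L => (c v == q) && (v != t) && (v != u) && (v < 6 * k)%N)).
      by rewrite lerDl; apply: sumr_ge0.
    by move=> v; case: (v < 6 * k)%N; rewrite /= ?andbT ?andbF -?andbA.
  have S2 : \sum_(v < L | ((v < 6 * k)%N && (c v == q)) && (v != t) && (v != u)) (m v - (1 - x)) <=
      \sum_(v < L | ((v < 6 * k)%N && (c v == q)) && (v != t) && (v != u)) s v.
    by apply: ler_sum => v _; have := m_s v; lra.
  rewrite (bigD1 t) // (bigD1 u) ?uq ?ut //=; have := m_s t; have := m_s u; lra.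
have : \sum_(t < L | (t < 6 * k)%N) (m t - (1 - x)) <= \sum_(q < 4 * k) (2 * x - 1).
  by rewrite (partition_big c xpredT) //; apply: ler_sum => q _; apply: q_le.
rewrite -(big_ord_widen L (fun t => m t - (1 - x)) leL).
rewrite -(big_mkord xpredT (fun t => m t - (1 - x))).
(* The first 2k goods truncate to [x] and the other 4k are unchanged: 2k(2x - 1) + sum - 4k(1 - x)
   <= 4k(2x - 1), that is, sum <= 2k. *)
rewrite (@big_cat_nat _ _ _ (2 * k)) //=; last by lia.
rewrite (eq_big_nat _ _ (F2 := fun=> 2 * x - 1)); last first.
  move=> t /andP[_ t2]; rewrite /m min_r; first by ring.
  by apply: s_noninc; lia.
rewrite [X in _ + X](eq_big_nat _ _ (F2 := fun t => s t - (1 - x))); last first.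
  by move=> t /andP[t2 _]; rewrite /m min_l //; apply: s_noninc.
rewrite [X in _ + X]sumrB !sumr_const_natl sumr_const card_ord -[X in _ <= X]mulr_natl.
have -> : (6 * k - 2 * k)%N = (4 * k)%N by lia.
rewrite subn0 !(natrM _ _ k); lra.
Qed.

Lemma sum_bags_ltn (j0 : 'I_(3 * k)) (g : nat -> R) :
  (forall j : 'I_(3 * k), \sum_(t < L | f t == j) s t <= g j) ->
  \sum_(t < L | f t == j0) s t < g j0 -> 4 * k%:R < \sum_(0 <= j < 3 * k) g j.
Proof.
by move=> le lt; rewrite big_mkord -sum_bags_value; apply: ltr_sum_le lt => j; apply: le.
Qed.

(** Let y = [b j1]. Bags up to [j1] are worth at most 1 + y. A later bare pair is worth at most 2
    [s j1] < 2 - 2y, a later filled bag at most 1 + y <= 2 - 2y. As at least 2k bags are of the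
    first kind, the total is below 2k(1 + y) + k(2 - 2y) = 4k. *)
Lemma stuck_light (j0 j1 : 'I_(3 * k)) :
  \sum_(t < L | f t == j0) s t < 1 -> (2 * k <= j1)%N -> s j1 + b j1 < 1 -> b j1 <= 1/3 ->
  False.
Proof.
move=> lt0 k1 lt1 b1.
have b0 : 0 <= b j1 by apply: s_ge0.
pose g (j : nat) : R := if (j <= j1)%N then 1 + b j1 else 2 - 2 * b j1.
have g1 j : 1 <= g j by rewrite /g; case: ifP => _; lra.
have le_g (j : 'I_(3 * k)) : \sum_(t < L | f t == j) s t <= g j.
  have jk := ltn_ord j; have j1k := ltn_ord j1.
  have aj1 : s j <= 1 by apply: s_le1; lia.
  rewrite /g; have [E|[e [rest [ek E lt]]]] := bag_split j; rewrite (E s) -/(b j); last first.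
    by have := filler_le j1 ek; case: ifP => _; lra.
  have baj := b_le jk.
  case: leqP => jj1; first by have := b_nondec jj1; lra.
  by have := s_noninc (ltnW jj1); lra.
have lt_g : \sum_(t < L | f t == j1) s t < g j1.
  rewrite /g leqnn; have [E|[e [rest [ek E lt]]]] := bag_split j1; rewrite (E s) -/(b j1).
    by lra.
  by have := filler_le j1 ek; lra.
have := sum_bags_ltn le_g lt_g.
have j1k := ltn_ord j1.
rewrite (@big_cat_nat _ _ _ j1.+1) //=.
rewrite (eq_big_nat _ _ (F2 := fun=> 1 + b j1)); last first.
  by move=> j /andP[_ jj]; rewrite /g -ltnS jj.
rewrite [X in _ + X](eq_big_nat _ _ (F2 := fun=> 2 - 2 * b j1)); last first.
  by move=> j /andP[jj _]; rewrite /g leqNgt jj.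
rewrite !sumr_const_natl subn0 natrB // (natrM _ _ k).
have : 2 * k%:R <= j1.+1%:R :> R by rewrite -natrM ler_nat; lia.
set J := j1.+1%:R; set K := k%:R; move=> JK.
have : 0 <= (1/3 - b j1) * (J - 2 * K) by apply: mulr_ge0; lra.
by rewrite /=; lra.
Qed.

(** Bags from [2 * k] on hold no filler, since their pairs already reach 1. Bounding each earlier
    bag by 1 + [b j], the total is below 2k plus the value of the goods from 2k to 6k - 1, which
    [sum_pairs_le] bounds by 2k. *)
Lemma stuck_heavy (j0 : 'I_(3 * k)) :
  \sum_(t < L | f t == j0) s t < 1 ->
  (forall j : 'I_(3 * k), (2 * k <= j)%N -> 1 <= s j + b j) -> False.
Proof.
move=> lt0 heavy.
pose g (j : nat) : R := b j + (if (j < 2 * k)%N then 1 else s j).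
have g1 (j : 'I_(3 * k)) : 1 <= g j.
  rewrite /g; case: ltnP => [_|/heavy]; last by rewrite addrC.
  by rewrite lerDr; apply: s_ge0.
have le_g (j : 'I_(3 * k)) : \sum_(t < L | f t == j) s t <= g j.
  have jk := ltn_ord j.
  have aj1 : s j <= 1 by apply: s_le1; lia.
  rewrite /g; have [E|[e [rest [ek E lt]]]] := bag_split j; rewrite (E s) -/(b j).
    by case: ltnP => _; lra.
  have := filler_le j ek.
  case: ltnP => [_|/heavy]; first lra.
  have : 0 <= \sum_(t < L | rest t) s t by apply: sumr_ge0.
  by lra.
have := sum_bags_ltn le_g (lt_le_trans lt0 (g1 j0)).
rewrite big_split /=.
have -> : \sum_(0 <= j < 3 * k) b j = \sum_(3 * k <= t < 6 * k) s t.
  transitivity (\sum_(0 + 3 * k <= t < 6 * k) s (3 * k + 6 * k - t.+1)%N); last first.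
    by rewrite add0n [RHS]big_nat_rev.
  rewrite big_addn.
  have -> : (6 * k - 3 * k)%N = (3 * k)%N by lia.
  by apply: eq_big_nat => j jk; rewrite /b; congr s; lia.
rewrite (@big_cat_nat _ _ _ (2 * k) 0 (3 * k)) //=; last by lia.
rewrite [X in _ + (X + _)](eq_big_nat _ _ (F2 := fun=> 1)); last by move=> j /andP[_ ->].
rewrite [X in _ + (_ + X)](eq_big_nat _ _ (F2 := s)); last first.
  by move=> j /andP[jk _]; rewrite ltnNge jk.
rewrite sumr_const_natl subn0.
have := sum_pairs_le; rewrite (@big_cat_nat _ _ _ (3 * k) (2 * k)) //=; try lia.
rewrite (natrM _ _ k); lra.
Qed.

Lemma stuck_false (j0 : 'I_(3 * k)) : \sum_(t < L | f t == j0) s t < 1 -> False.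
Proof.
move=> lt1.
case: (@arg_maxP _ _ _ j0 xpredT (fun j : 'I_(3 * k) => s j + b j) isT) => js _ /= jmax.
have jmax' (j : 'I_(3 * k)) : s j + b j <= s js + b js := jmax j isT.
have k0 := ltn_ord j0; have jsk := ltn_ord js.
have bj0 : b j0 < 1/2.
  have := b_le k0.
  have [E|[e [rest [ek E _]]]] := bag_split j0; move: lt1; rewrite (E s) -/(b j0); first lra.
  have : 0 <= \sum_(t < L | rest t) s t by apply: sumr_ge0.
  have := s_ge0 e; lra.
have b0 : b 0 < 1/2 by apply: le_lt_trans (b_nondec (leq0n j0)) bj0.
have le1 (j : 'I_(3 * k)) : s j <= 1 by apply: s_le1; have := ltn_ord j; lia.
have pos (j : 'I_(3 * k)) : [/\ 0 <= b j, b 0 <= b j & b j <= s j].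
  by split; [apply: s_ge0|apply: b_nondec|apply: b_le; apply: ltn_ord].
have [pjs|pjs] := lerP (s js + b js - 1) (1/3).
  have [b03|b03] := lerP (b 0) (1/3).
    (* At step 1/3 the flat stretches vanish and no loss is required. *)
    apply: (@staircase_bags (1/3) j0) => //; try lra; first by move=> j; have := jmax' j; lra.
    move=> j _; have [p1 p2 p3] := pos j.
    have := @staircase_le _ (1/3) (s j); have := @staircase_le _ (1/3) (b j); lra.
  (* Every good of a pair is at least [b 0], so each of the two loses 3x - 1. *)
  apply: (@staircase_bags (b 0) j0) => //; try lra; first by move=> j; have := jmax' j; lra.
  move=> j _; have [p1 p2 p3] := pos j; have p4 := le1 j.
  have := @staircase_le_mid _ (b 0) (s j); have := @staircase_le_mid _ (b 0) (b j); lra.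
have [pb|pb] := lerP (s js + b js - 1) (b 0).
  apply: (@staircase_bags (b 0) j0) => //; try lra; first by move=> j; have := jmax' j; lra.
  move=> j _; have [p1 p2 p3] := pos j; have p4 := le1 j.
  have := @staircase_le_mid _ (b 0) (s j); have := @staircase_le_mid _ (b 0) (b j); lra.
have [bs|bs] := ltrP (b js) (1/2).
  have sjs := le1 js.
  apply: (@staircase_bags (s js + b js - 1) j0) => //; try lra.
    by move=> j; have := jmax' j; lra.
  move=> j _; have [p1 p2 p3] := pos j; have p4 := le1 j.
  (* Write x for the step. From [js] on, both goods are at least [b js] >= x, as [s js <= 1], and
     each loses 3x - 1. Before [js], the larger good is at least [s js] >= 2x and loses both
     stretches alone. *)
  have [jj|jj] := leqP js j.
    have p5 := b_nondec jj.
    have := @staircase_le_mid _ (s js + b js - 1) (s j).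
    have := @staircase_le_mid _ (s js + b js - 1) (b j); lra.
  have p5 := s_noninc (ltnW jj).
  have := @staircase_top _ (s js + b js - 1) (s j).
  have := @staircase_le _ (s js + b js - 1) (b j); lra.
have [j1 /andP[k1 lt_j1]|none] := pickP (fun j : 'I_(3 * k) => (2 * k <= j)%N && (s j + b j < 1)).
  apply: (@stuck_light j0 j1) => //; have [_ _ p3] := pos j1; have [_ _ p4] := pos js.
  (* After [js] both goods would be at least 1/2. Hence [s j1 >= s js > 2/3], which leaves [b j1]
     below 1/3. *)
  have jj : (j1 <= js)%N.
    by case: leqP => // /ltnW /b_nondec; lra.
  have := s_noninc jj; lra.
apply: (@stuck_heavy j0) => // j jk; have := none j; rewrite jk /=.
by rewrite ltNge => /negbFE.
Qed.
End Stuck.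

(** * Ordered instances and the picking sequence *)

Lemma ordered_allocation (R : realFieldType) (N : finType) (k L : nat) (A : {set N})
    (s : N -> nat -> R) (c : N -> 'I_L -> 'I_(4 * k)) :
  (0 < k)%N -> (#|A| <= 3 * k)%N -> (6 * k <= L)%N ->
  (forall i t, 0 <= s i t) -> (forall i t u, (t <= u)%N -> s i u <= s i t) ->
  {in A, forall i, forall q, \sum_(t < L | c i t == q) s i t = 1} ->
  exists owner : 'I_L -> option N,
    {in A, forall i, 1 <= \sum_(t < L | owner t == Some i) s i t}.
Proof.
move=> k0 cA leL s0 s_dec bundle1.
have k30 : (0 < 3 * k)%N by lia.
pose j0 := Ordinal k30.
pose base (j : 'I_(3 * k)) := [set t : 'I_L | (t == j :> nat) || (t == (6 * k - j.+1)%N :> nat)].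
pose P := [set t : 'I_L | (6 * k <= t)%N].
pose to_bag (f : 'I_L -> 'I_(3 * k)) (t : 'I_L) : 'I_(3 * k) :=
  if (t < 6 * k)%N then insubd j0 (if (t < 3 * k)%N then t : nat else (6 * k - t.+1)%N)
  else f t.
have base_to_bag f (t : 'I_L) (j : 'I_(3 * k)) : (t < 6 * k)%N ->
    (to_bag f t == j) = (t == j :> nat) || (t == (6 * k - j.+1)%N :> nat).
  move=> t6; rewrite /to_bag t6 -val_eqE val_insubd; have := ltn_ord j.
  by case: (ltnP t (3 * k)) => t3 /=; case: ifP => /=; lia.
have in_bag f t j : (t \in bag base P f j) = (to_bag f t == j).
  rewrite !inE; case: ltnP => [t6|t6] /=; first by rewrite orbF base_to_bag.
  rewrite /to_bag ltnNge t6 /=; have := ltn_ord j.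
  case: (f t == j); rewrite ?orbT ?orbF //; lia.
have cAB : (#|A| <= #|[set: 'I_(3 * k)]|)%N by rewrite cardsT card_ord.
have [[h [f [h_inj _ h1]]]|] := bag_filling base j0 P (fun i t => s0 i (val t)) cAB.
  exists (fun t => [pick i in A | to_bag f t == h i]) => i iA.
  apply: le_trans (h1 i iA) _; rewrite le_eqVlt; apply/orP; left; apply/eqP.
  apply: eq_bigl => t; rewrite in_bag; case: pickP => [i' /andP[i'A /eqP ->]|none].
    by apply/eqP/eqP => [/h_inj -> //|[->]].
  by have := none i; rewrite iA.
move=> [i [f [iA _ fill [j _ jlt]]]]; exfalso.
apply: (@stuck_false _ _ _ (s i) (c i) (to_bag f) _ _ leL _ _ _ j) => //.
- exact: s_dec.
- exact: bundle1.
- exact: base_to_bag.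
- move=> j'; have [none|[e [eP fe lt]]] := fill j' (in_setT j'); [left|right].
    move=> t tj; rewrite ltnNge; apply/negP => t6.
    have tP : t \in P by rewrite inE t6.
    by move: tj (none t tP); rewrite /to_bag ltnNge t6 /= => ->; rewrite eqxx.
  rewrite inE in eP; exists e; split => //; first by rewrite /to_bag ltnNge eP.
  by move: lt; congr (_ < _); apply: eq_bigl => t; rewrite in_setD1 in_bag andbC.
- by move: jlt; congr (_ < _); apply: eq_bigl => t; rewrite in_bag.
Qed.

(** At turn [t] only [t] goods are gone, while more than [t] goods are worth at least [s i t] to the
    owner [i]. *)
Lemma picking_sequence (R : realFieldType) (N M : finType) (u : N -> M -> R)
    (s : N -> nat -> R) (owner : nat -> option N) (g0 : M) :
  (forall i t, (t < #|M|)%N -> (t < #|[set g | (s i t <= u i g)%R]|)%N) ->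
  forall t, (t <= #|M|)%N -> exists l : seq M, [/\ size l = t, uniq l &
    forall r i, (r < t)%N -> owner r = Some i -> s i r <= u i (nth g0 l r)].
Proof.
move=> many; elim=> [_|t IH tM]; first by exists [::].
have [l [sl ul lP]] := IH (ltnW tM).
have fresh (S : {set M}) : (t < #|S|)%N -> exists2 g, g \in S & g \notin l.
  move=> tS; apply/subsetPn; apply: contraL tS => /subset_leq_card le.
  by rewrite -leqNgt -sl (leq_trans le) // card_size.
have [g gl gP] : exists2 g, g \notin l & forall i, owner t = Some i -> s i t <= u i g.
  (* An unowned turn still removes a good, so that positions in [l] remain turns. *)
  case: (owner t) => [i|]; last first.
    by have [|g _ gl] := fresh setT; [rewrite cardsT|exists g].
  by have [g] := fresh _ (many i t tM); rewrite inE => gu gl; exists g => // _ [<-].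
exists (rcons l g); rewrite size_rcons sl rcons_uniq gl ul; split=> // r i.
rewrite ltnS leq_eqVlt nth_rcons sl => /orP[/eqP ->|rt].
  by rewrite ltnn eqxx; apply: gP.
by rewrite rt; apply: lP.
Qed.

Lemma normalised_allocation (R : realFieldType) (N M : finType) (k : nat) (A : {set N})
    (u : N -> M -> R) (col : N -> M -> 'I_(4 * k)) :
  (0 < k)%N -> (#|A| <= 3 * k)%N -> (forall i g, 0 <= u i g) ->
  {in A, forall i, forall q, \sum_(g | col i g == q) u i g = 1} ->
  exists X : N -> {set M}, (forall i j, i != j -> [disjoint X i & X j]) /\
    {in A, forall i, 1 <= \sum_(g in X i) u i g}.
Proof.
move=> k0 cA u0 bundle1.
have [g0 _|M0] := pickP M; last first.
  exists (fun=> set0); split=> [i j _|i iA]; first by rewrite -setI_eq0 set0I.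
  have q : 'I_(4 * k) by apply: (@Ordinal _ 0); lia.
  by have /eqP := bundle1 i iA q; rewrite big_pred0 ?(eq_sym 0) ?oner_eq0 // => g; have := M0 g.
pose o i := sort (relpre (u i) >=%R) (enum M).
have o_perm i : perm_eq (o i) (enum M) by rewrite /o perm_sort.
have o_size i : size (o i) = #|M| by rewrite (perm_size (o_perm i)) -cardE.
have o_uniq i : uniq (o i) by rewrite (perm_uniq (o_perm i)) enum_uniq.
pose s i t := nth 0 (map (u i) (o i)) t.
have sE i t : (t < #|M|)%N -> s i t = u i (nth g0 (o i) t).
  by move=> tM; rewrite /s (nth_map g0) ?o_size.
have s_out i t : (#|M| <= t)%N -> s i t = 0.
  by move=> tM; rewrite /s nth_default // size_map o_size.
have s0 i t : 0 <= s i t.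
  by case: (ltnP t #|M|) => tM; [rewrite sE|rewrite s_out].
have s_dec i t v : (t <= v)%N -> s i v <= s i t.
  move=> tv; case: (ltnP v #|M|) => vM; last by rewrite (s_out i v).
  have sorted_s : sorted >=%R (map (u i) (o i)).
    rewrite sorted_map; apply: sort_sorted => g h /=; exact: le_total.
  apply: (sorted_leq_nth _ _ 0 sorted_s) => //; rewrite ?inE ?size_map ?o_size //.
  - by move=> x y z yx zx; apply: le_trans zx yx.
  - by move=> x; exact: lexx.
  - exact: leq_ltn_trans tv vM.
pose L := maxn #|M| (6 * k).
(* Padding goods beyond [#|M|] get the colour of [g0]; being worth 0, they leave the bundle sums
   unchanged. *)
pose c i (t : 'I_L) := col i (nth g0 (o i) t).
have cL : (#|M| <= L)%N by apply: leq_maxl.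
have trunc i' (Q : pred nat) : \sum_(t < L | Q t) s i' t = \sum_(0 <= t < #|M| | Q t) s i' t.
  rewrite -(big_mkord Q (s i')) (@big_cat_nat _ _ _ #|M|) //= [X in _ + X]big_nat_cond.
  by rewrite [X in _ + X]big1 ?addr0 // => t /andP[/andP[tM _] _]; apply: s_out.
have bundle_c : {in A, forall i, forall q, \sum_(t < L | c i t == q) s i t = 1}.
  move=> i iA q; rewrite -(bundle1 i iA q) (trunc i (fun t => col i (nth g0 (o i) t) == q)).
  rewrite big_nat_cond.
  rewrite (eq_bigr (fun t => u i (nth g0 (o i) t))); last first.
    by move=> t /andP[/andP[_ tM] _]; apply: sE.
  rewrite -big_nat_cond -(o_size i) -(big_nth g0 (fun g => col i g == q) (u i)).
  by rewrite (perm_big _ (o_perm i)) /= big_enum_cond.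
have [owner ownerP] := ordered_allocation k0 cA (leq_maxr _ _) s0 s_dec bundle_c.
pose ow t := obind owner (insub t).
have many i t : (t < #|M|)%N -> (t < #|[set g | (s i t <= u i g)%R]|)%N.
  move=> tM; have := take_uniq t.+1 (o_uniq i) => /card_uniqP ct.
  have : size (take t.+1 (o i)) = t.+1 by rewrite size_takel // o_size.
  rewrite -ct => {1}<-; apply/subset_leq_card/subsetP => g /(nthP g0)[r].
  rewrite size_takel ?o_size // => rt <-; rewrite inE nth_take // -sE; last exact: leq_trans rt tM.
  exact: s_dec.
have [l [sl ul lP]] := picking_sequence ow g0 many (leqnn _).
exists (fun i => [set g in l | ow (index g l) == Some i]); split=> [i j ij|i iA].
  rewrite -setI_eq0; apply/eqP/setP => g; rewrite !inE; apply/negP.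
  by move=> /andP[/andP[_ /eqP ->] /andP[_ /eqP[e]]]; rewrite e eqxx in ij.
apply: le_trans (ownerP i iA) _.
rewrite (eq_bigl (fun t : 'I_L => ow t == Some i)); last by move=> t; rewrite /ow valK.
rewrite (trunc i (fun t => ow t == Some i)).
have -> : \sum_(g in [set g in l | ow (index g l) == Some i]) u i g =
    \sum_(g <- l | ow (index g l) == Some i) u i g.
  rewrite [RHS]big_mkcond /= big_uniq // -big_mkcondr /=.
  by apply: eq_bigl => g; rewrite !inE.
rewrite (big_nth g0) sl [leLHS]big_nat_cond [leRHS]big_nat_cond.
rewrite [leRHS](eq_bigl (fun t => (0 <= t < #|M|)%N && (ow t == Some i))); last first.
  by move=> t /=; case: (ltnP t #|M|) => // tM; rewrite index_uniq ?sl.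
by apply: ler_sum => t /andP[/andP[_ tM] /eqP owt]; apply: lP.
Qed.

(** * Normalisation and conclusion *)

(** Each good is divided by the value of its bundle in an optimal partition. That value is at least
    the share, so normalised value 1 is worth at least the share. *)
Lemma MMS_normalise (R : realType) (M : finType) (v : {set M} -> R) (d : nat) :
  (0 < d)%N -> additive_valuation v ->
  exists uc : (M -> R) * (M -> 'I_d),
    [/\ forall g, 0 <= uc.1 g,
        0 < MMS v d -> forall q, \sum_(g | uc.2 g == q) uc.1 g = 1 &
        forall S : {set M}, 0 < MMS v d -> 1 <= \sum_(g in S) uc.1 g -> MMS v d <= v S].
Proof.
move=> d0 va; have [v0 vD] := va; have [[P Ppart PE] _] := MMS_max d0 va.
have [_ minP] := min_value_min P d0 va.
have /fin_all_exists[col colP] (g : M) : exists q, g \in P q.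
  by have := in_setT g; case/andP: Ppart => _ /eqP <- /bigcupP[q _ gq]; exists q.
have colE g q : (col g == q) = (g \in P q).
  apply/eqP/idP => [<-|gq]; first exact: colP.
  apply/eqP; apply: contraTT gq => ne; case/andP: Ppart => /forallP/(_ (col g)) /forallP/(_ q).
  by rewrite ne => /pred0P/(_ g) /=; rewrite colP /= => ->.
exists (fun g => v [set g] / v (P (col g)), col); split=> /= [g|mu0 q|S mu0 S1].
- by rewrite divr_ge0.
- have Pq : v (P q) != 0 by rewrite gt_eqF // (lt_le_trans mu0) // PE.
  rewrite (eq_bigr (fun g => v [set g] / v (P q))) => [|g /eqP -> //].
  rewrite -mulr_suml (eq_bigl _ _ (fun g => colE g q)) -vD; exact: divff.
- rewrite -[leLHS]mulr1; apply: le_trans (ler_wpM2l (ltW mu0) S1) _.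
  rewrite mulr_sumr (vD S); apply: ler_sum => g _.
  have Pg : MMS v d <= v (P (col g)) by rewrite PE.
  by rewrite mulrCA ler_piMr // ler_pdivrMr ?mul1r // (lt_le_trans mu0).
Qed.

Theorem theorem1 (R : realType) (n : nat) (N M : finType)
    (v : N -> {set M} -> R)
    (hn : (1 <= n)%N) (hN : #|N| = n)
    (hv : forall i : N, additive_valuation (v i)) :
  exists X : {ffun N -> {set M}},
    bundle_partition X /\
    (forall i : N, MMS (v i) (4 * ceil_div n 3)%N <= v i (X i)).
Proof.
set k := ceil_div n 3.
have [k0 nk] : (0 < k)%N /\ (n <= 3 * k)%N by rewrite /k /ceil_div; lia.
have d0 : (0 < 4 * k)%N by lia.
have /fin_all_exists[uc ucP] i := MMS_normalise d0 (hv i).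
(* The other agents have share 0 and accept any bundle. *)
pose A := [set i | 0 < MMS (v i) (4 * k)].
have [||i g|i|X [Xdis X1]] :=
  @normalised_allocation _ N M k A (fun i => (uc i).1) (fun i => (uc i).2).
- by [].
- by rewrite (leq_trans (max_card _)) // hN.
- by have [] := ucP i.
- by rewrite inE => mu0 q; have [_ + _] := ucP i; apply.
have /card_gt0P[i0 _] : (0 < #|N|)%N by rewrite hN.
(* Unallocated goods go to an arbitrary agent [i0]. *)
pose rest := ~: \bigcup_i X i.
exists [ffun i => X i :|: (if i == i0 then rest else set0)]; split.
  have rest_dis i : [disjoint X i & rest].
    by rewrite disjoints_subset setCK; apply: bigcup_sup.
  apply/andP; split.
    apply/forallP => i; apply/forallP => j; apply/implyP => ij; rewrite !ffunE.
    have /pred0P Xij := Xdis i j ij.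
    have /pred0P Xi := rest_dis i; have /pred0P Xj := rest_dis j.
    apply/pred0P => g; move: (Xij g) (Xi g) (Xj g) => /=; rewrite !in_setU.
    have [ei|_] := eqVneq i i0; have [ej|_] := eqVneq j i0;
      rewrite ?in_set0; first (by rewrite ei ej eqxx in ij);
      by case: (g \in X i); case: (g \in X j); case: (g \in rest).
  apply/eqP/setP => g; rewrite inE; apply/bigcupP.
  have [/bigcupP[i _ gi]|ng] := boolP (g \in \bigcup_i X i).
    by exists i => //; rewrite ffunE inE gi.
  by exists i0 => //; rewrite ffunE eqxx !inE ng orbT.
move=> i; rewrite ffunE; have [vi0 viD] := hv i.
have [mu0|] := ltrP 0 (MMS (v i) (4 * k)); last by move=> h; apply: le_trans h (vi0 _).
have [_ _ ucv] := ucP i.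
apply: ucv => //; apply: le_trans (X1 i _) _; first by rewrite inE.
by apply: ler_sum_subset; [have [] := ucP i|apply: subsetUl].
Qed.
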